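(* Let $p$ be a prime and let $f(x)=a_0+a_1x+\cdots+a_mx^m\in\mathbb{Z}_p[x]$. Let $\nu,\kappa\in\mathbb{Z}$ with $0\le 2\kappa<\nu$. Suppose $r_0\in\mathbb{Z}$ satisfies $f(r_0)\equiv 0\pmod{p^\nu}$ and $v_p(f'(r_0))=\kappa$. Put $c_j=p^{(j-2)\kappa}\frac{f^{(j)}(r_0)}{j!}$ for $j=0,1,\dots,m$ (and $c_j=0$ for $j>m$). Then the series \[ r=r_0+p^\kappa\sum_{n=0}^\infty\bigg[\sum_{k=0}^n\frac{(-1)^{n-k+1}}{c_1^k\,(n+1)!}\binom{2n+1}{n-k}B_{n+k,k}(1!\,c_1,2!\,c_2,\dots)\bigg]\Big(\frac{c_0}{c_1}\Big)^{n+1} \] converges in $\mathbb{Z}_p$, and $r$ is a $p$-adic root of $f$ lifting $r_0$.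
   Context: $v_p$ is the $p$-adic valuation and $\mathbb{Z}_p$ the ring of $p$-adic integers. For a sequence $x_1,x_2,\dots$, the $(n,k)$-th partial Bell polynomial is $B_{n,k}(x_1,x_2,\dots)=\sum \frac{n!}{i_1!i_2!\cdots}\left(\frac{x_1}{1!}\right)^{i_1}\left(\frac{x_2}{2!}\right)^{i_2}\cdots$, the sum over all sequences $(i_1,i_2,\dots)$ of nonnegative integers with $i_1+i_2+\cdots=k$ and $i_1+2i_2+\cdots=n$ (with $B_{0,0}=1$). *)

(* Defs.v *)
From HB Require Import structures.
From mathcomp Require Import all_boot all_order all_algebra.
From mathcomp Require Import boolp classical_sets constructive_ereal filter.
From mathcomp Require Import topology sequences.

Set Implicit Arguments.
Unset Strict Implicit.
Unset Printing Implicit Defensive.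

Import Order.TTheory GRing.Theory Num.Theory.

Local Open Scope ring_scope.

(* Z_p as the inverse limit of the rings Z/p^n: [padic_res x n] is the residue
   of x modulo p^n, represented by an integer in [0, p^n).  The condition
   padic_coh both normalizes the residues and makes them compatible. *)
Record padic_int (p : nat) (p_pr : prime p) := PadicInt {
  padic_res : nat -> int;
  padic_coh : forall n, padic_res n = (padic_res n.+1 %% (p ^ n)%N)%Z
}.

HB.instance Definition _ (p : nat) (p_pr : prime p) :=
  gen_eqMixin (padic_int p_pr).
HB.instance Definition _ (p : nat) (p_pr : prime p) :=
  gen_choiceMixin (padic_int p_pr).

Lemma padic_eqP (p : nat) (p_pr : prime p) (x y : padic_int p_pr) :
  (forall n, padic_res x n = padic_res y n) -> x = y.
Proof.
case: x y => [u hu] [v hv] /= /funext uv; rewrite uv in hu *.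
by congr PadicInt; exact: Prop_irrelevance.
Qed.

Lemma modz_expS (p : nat) (a : int) (n : nat) :
  ((a %% (p ^ n.+1)%N)%Z %% (p ^ n)%N)%Z = (a %% (p ^ n)%N)%Z.
Proof.
rewrite {2}(divz_eq a (p ^ n.+1)%N) expnSr PoszM [X in (X + _)%R]mulrA.
by rewrite [_ * _ * Posz p]mulrAC modzMDl.
Qed.

Lemma padic_res_small (p : nat) (p_pr : prime p) (x : padic_int p_pr) n :
  (padic_res x n %% (p ^ n)%N)%Z = padic_res x n.
Proof. by rewrite [in LHS]padic_coh modz_mod -padic_coh. Qed.

Lemma padic_res_le (p : nat) (p_pr : prime p) (x : padic_int p_pr) m n :
  (m <= n)%N -> (padic_res x n %% (p ^ m)%N)%Z = padic_res x m.
Proof.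
move=> /subnK <-; elim: (n - m)%N => [|k IH]; first exact: padic_res_small.
rewrite -IH (padic_coh x (k + m)); apply/esym.
rewrite [in LHS]expnD PoszM {2}(divz_eq (padic_res x (k.+1 + m)) (p ^ k * p ^ m)%N).
by rewrite PoszM mulrA modzMDl.
Qed.

(* The p-adic integer with given residues, from a sequence of representatives
   that is coherent but not necessarily normalized. *)
Lemma padic_mk_coh (p : nat) (u : nat -> int) :
  (forall n, (u n.+1 %% (p ^ n)%N)%Z = (u n %% (p ^ n)%N)%Z) ->
  forall n, (u n %% (p ^ n)%N)%Z = ((u n.+1 %% (p ^ n.+1)%N)%Z %% (p ^ n)%N)%Z.
Proof. by move=> hu n; rewrite modz_expS hu. Qed.

Definition padic_mk (p : nat) (p_pr : prime p) (u : nat -> int)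
    (hu : forall n, (u n.+1 %% (p ^ n)%N)%Z = (u n %% (p ^ n)%N)%Z) :
  padic_int p_pr := PadicInt p_pr (padic_mk_coh hu).

Section PadicRing.
Variables (p : nat) (p_pr : prime p).
Implicit Types x y z : padic_int p_pr.

Fact padic_const_coh (a : int) (n : nat) :
  (a %% (p ^ n)%N)%Z = (a %% (p ^ n)%N)%Z.
Proof. by []. Qed.

Fact padic_opp_coh x n :
  (- padic_res x n.+1 %% (p ^ n)%N)%Z = (- padic_res x n %% (p ^ n)%N)%Z.
Proof. by rewrite -modzNm -padic_coh. Qed.

Fact padic_add_coh x y n :
  ((padic_res x n.+1 + padic_res y n.+1) %% (p ^ n)%N)%Z =
  ((padic_res x n + padic_res y n) %% (p ^ n)%N)%Z.
Proof. by rewrite -modzDm -!padic_coh. Qed.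

Fact padic_mul_coh x y n :
  ((padic_res x n.+1 * padic_res y n.+1) %% (p ^ n)%N)%Z =
  ((padic_res x n * padic_res y n) %% (p ^ n)%N)%Z.
Proof. by rewrite -modzMm -!padic_coh. Qed.

Definition padic_const a := padic_mk p_pr (padic_const_coh a).
Definition padic_opp x := padic_mk p_pr (padic_opp_coh x).
Definition padic_add x y := padic_mk p_pr (padic_add_coh x y).
Definition padic_mul x y := padic_mk p_pr (padic_mul_coh x y).

Fact padic_addA : associative padic_add.
Proof. by move=> x y z; apply: padic_eqP => n /=; rewrite modzDml modzDmr addrA. Qed.
Fact padic_addC : commutative padic_add.
Proof. by move=> x y; apply: padic_eqP => n /=; rewrite addrC. Qed.
Fact padic_add0 : left_id (padic_const 0) padic_add.
Proof.
by move=> x; apply: padic_eqP => n /=; rewrite modzDml add0r padic_res_small.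
Qed.
Fact padic_addN : left_inverse (padic_const 0) padic_opp padic_add.
Proof. by move=> x; apply: padic_eqP => n /=; rewrite modzDml addNr. Qed.

HB.instance Definition _ := GRing.isZmodule.Build (padic_int p_pr)
  padic_addA padic_addC padic_add0 padic_addN.

Fact padic_mulA : associative padic_mul.
Proof. by move=> x y z; apply: padic_eqP => n /=; rewrite modzMml modzMmr mulrA. Qed.
Fact padic_mulC : commutative padic_mul.
Proof. by move=> x y; apply: padic_eqP => n /=; rewrite mulrC. Qed.
Fact padic_mul1 : left_id (padic_const 1) padic_mul.
Proof.
by move=> x; apply: padic_eqP => n /=; rewrite modzMml mul1r padic_res_small.
Qed.
Fact padic_mulD : left_distributive padic_mul padic_add.
Proof.
by move=> x y z; apply: padic_eqP => n /=; rewrite modzMml modzDm mulrDl.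
Qed.
Fact padic_oner_neq0 : padic_const 1 != 0 :> padic_int p_pr.
Proof.
apply/eqP => /(congr1 (fun x => padic_res x 1)) /=; rewrite expn1 mod0z.
by rewrite modz_small //= ltz_nat prime_gt1.
Qed.

HB.instance Definition _ := GRing.Zmodule_isComNzRing.Build (padic_int p_pr)
  padic_mulA padic_mulC padic_mul1 padic_mulD padic_oner_neq0.

Lemma padic_res0 n : padic_res (0 : padic_int p_pr) n = 0.
Proof. by rewrite /= mod0z. Qed.

Definition padic_unit : {pred padic_int p_pr} :=
  fun x => `[< exists y, y * x = 1 >].
Definition padic_inv x : padic_int p_pr := xget x [set y | y * x = 1]%classic.

Fact padic_mulVx : {in padic_unit, left_inverse 1 padic_inv *%R}.
Proof. by move=> x /asboolP [y yx1]; rewrite /padic_inv; case: xgetP => // /(_ y). Qed.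
Fact padic_unitPl x y : y * x = 1 -> padic_unit x.
Proof. by move=> yx1; apply/asboolP; exists y. Qed.
Fact padic_inv_out : {in [predC padic_unit], padic_inv =1 id}.
Proof.
move=> x /asboolP nx; rewrite /padic_inv; case: xgetP => // y _ /= yx1.
by case: nx; exists y.
Qed.

HB.instance Definition _ := GRing.ComNzRing_hasMulInverse.Build
  (padic_int p_pr) padic_mulVx padic_unitPl padic_inv_out.

Lemma padic_neq0P x : x != 0 -> exists n, padic_res x n != 0.
Proof.
apply: contra_neqP => x0; apply: padic_eqP => n; rewrite padic_res0.
by apply/eqP/negP => /negP xn; apply: x0; exists n.
Qed.

Fact padic_idomain : GRing.integral_domain_axiom (padic_int p_pr).
Proof.
move=> x y xy0; apply/norP => -[/padic_neq0P [a xa] /padic_neq0P [b yb]].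
have := congr1 (fun z => padic_res z (a + b)) xy0; rewrite padic_res0 /=.
have ndvd z c N : (c <= N)%N -> padic_res z c != 0 ->
    (0 < `|padic_res z N|)%N /\ (logn p `|padic_res z N| < c)%N.
  move=> cN zc; suff H : ~~ (p ^ c %| `|padic_res z N|)%N.
    have z0 : (0 < `|padic_res z N|)%N.
      by rewrite lt0n; apply: contraNneq H => ->; rewrite dvdn0.
    by split=> //; rewrite ltnNge -pfactor_dvdn.
  apply: contraNN zc => H; rewrite -(padic_res_le z cN).
  by apply/eqP/dvdz_mod0P; rewrite dvdzE absz_nat.
have [x0 lx] := ndvd x a (a + b)%N (leq_addr b a) xa.
have [y0 ly] := ndvd y b (a + b)%N (leq_addl a b) yb.
move=> /dvdz_mod0P; rewrite dvdzE absz_nat abszM pfactor_dvdn ?muln_gt0 ?x0 //.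
by rewrite lognM // leqNgt -addSn leq_add // ltnW.
Qed.

HB.instance Definition _ := GRing.ComUnitRing_isIntegral.Build (padic_int p_pr)
  padic_idomain.

(* The p-adic topology: the sets x + p^n Z_p = {y | y and x have the same
   residue mod p^n} are a neighbourhood base at x. *)
Definition padic_nbhs x : set_system (padic_int p_pr) :=
  filter_from setT (fun n => [set y | padic_res y n = padic_res x n])%classic.

HB.instance Definition _ := hasNbhs.Build (padic_int p_pr) padic_nbhs.

Fact padic_nbhs_filter x : ProperFilter (nbhs x).
Proof.
apply: filter_from_proper => [|n _]; last by exists x.
apply: filter_from_filter => [|i j _ _]; first by exists 0%N.
exists (maxn i j) => // y /= yx; split => /=.
  by rewrite -(padic_res_le y (leq_maxl i j)) yx padic_res_le ?leq_maxl.
by rewrite -(padic_res_le y (leq_maxr i j)) yx padic_res_le ?leq_maxr.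
Qed.

Fact padic_nbhs_singleton x (A : set (padic_int p_pr)) : nbhs x A -> A x.
Proof. by move=> [n _]; apply. Qed.

Fact padic_nbhs_nbhs x (A : set (padic_int p_pr)) :
  nbhs x A -> nbhs x (nbhs^~ A).
Proof.
move=> [n _ xA]; exists n => // y /= yx.
by exists n => // z /= zy; apply: xA => /=; rewrite zy.
Qed.

HB.instance Definition _ := Nbhs_isNbhsTopological.Build (padic_int p_pr)
  padic_nbhs_filter padic_nbhs_singleton padic_nbhs_nbhs.

Lemma padic_hausdorff : hausdorff_space (padic_int p_pr).
Proof.
move=> x y xy; apply: padic_eqP => n.
have [||z [/= -> ->]] // := xy [set z | padic_res z n = padic_res x n]%classic
  [set z | padic_res z n = padic_res y n]%classic; by exists n.
Qed.

Lemma padic_natE (k n : nat) :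
  padic_res (k%:R : padic_int p_pr) n = (k%:Z %% (p ^ n)%N)%Z.
Proof.
elim: k => [|k IH]; first by rewrite padic_res0 mod0z.
by rewrite -natr1 /= IH modzDm -addn1 PoszD.
Qed.

Lemma padic_dvdP x n :
  padic_res x n = 0 <-> exists z : padic_int p_pr, x = p%:R ^+ n * z.
Proof.
have pn0 : (p ^ n)%N%:Z != 0 by rewrite eqz_nat -lt0n expn_gt0 prime_gt0.
split=> [xn0|[z ->]]; last first.
  by rewrite -natrX /= padic_natE modzz mul0r mod0z.
have dvd k : ((p ^ n)%N %| padic_res x (k + n))%Z.
  by apply/dvdz_mod0P; rewrite padic_res_le ?leq_addl.
pose u k := (padic_res x (k + n) %/ (p ^ n)%N)%Z.
have hu k : (u k.+1 %% (p ^ k)%N)%Z = (u k %% (p ^ k)%N)%Z.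
  apply/eqP; rewrite eqz_mod_dvd -(dvdz_mul2r pn0) mulrBl !divzK //.
  rewrite -PoszM -expnD -eqz_mod_dvd.
  by rewrite padic_res_small padic_res_le ?leq_add2r.
exists (padic_mk p_pr hu); apply: padic_eqP => k.
rewrite -natrX /= padic_natE modzMm mulrC divzK //.
by rewrite padic_res_le ?leq_addr.
Qed.

(* v_p(x) is the largest n with x = 0 mod p^n, and +oo if there is none. *)
Definition padic_val x : \bar int :=
  if pselect (exists n, padic_res x n.+1 != 0) is left h
  then ((ex_minn h)%:Z)%:E else +oo%E.

(* x = y mod p^n, for an integer n >= 0. *)
Definition padic_eqmod (n : int) x y : Prop :=
  exists z : padic_int p_pr, x - y = p%:R ^ n * z.

End PadicRing.

Definition padic_num (p : nat) (p_pr : prime p) : fieldType :=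
  {fraction padic_int p_pr}.

Definition padic_emb (p : nat) (p_pr : prime p) (x : padic_int p_pr) :
  padic_num p_pr := tofrac x.

(* The multiplicity i_j is [i (j-1)].  The constraint sum_j j * i_j = n forces
   i_j = 0 for j > n and i_j <= n, so the sum ranges over finitely many
   sequences, indexed by {ffun 'I_n -> 'I_n.+1}. *)
Definition bell_poly (F : fieldType) (n k : nat) (x : nat -> F) : F :=
  \sum_(i : {ffun 'I_n -> 'I_n.+1}
        | ((\sum_(j < n) i j)%N == k) && ((\sum_(j < n) j.+1 * i j)%N == n))
    n`!%:R / (\prod_(j < n) (i j)`!)%N%:R
      * \prod_(j < n) (x j.+1 / j.+1`!%:R) ^+ i j.

Definition hensel_c (p : nat) (p_pr : prime p) (f : {poly padic_int p_pr})
    (m : nat) (kappa r0 : int) (j : nat) : padic_num p_pr :=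
  if (j <= m)%N then
    p%:R ^ ((j%:Z - 2) * kappa) * (padic_emb (f^`(j)).[r0%:~R] / j`!%:R)
  else 0.

Definition hensel_term (F : fieldType) (c : nat -> F) (n : nat) : F :=
  (\sum_(k < n.+1)
     (-1) ^+ (n - k).+1 / (c 1%N ^+ k * n.+1`!%:R) * 'C(n.*2.+1, n - k)%:R
       * bell_poly (n + k) k (fun j => j`!%:R * c j))
  * (c 0%N / c 1%N) ^+ n.+1.

(* Main.v *)
(* Put c_0 = p^(-2 kappa) f(r0), so that f(r0 + p^kappa y) =
   p^(2 kappa) c_1 (G(y) - w) with w = - c_0 / c_1 and G = x u, u = 1 + ...,
   over Z_p.  The compositional inverse Y of G has coefficients in Z_p, and as
   p divides w, the series S = Y(w) converges and G(S) = w.  It remains to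
   identify the coefficients of Y.  Lagrange inversion gives
   Y_(n+1) = [x^n] u^(-n-1) / (n+1).  Since u(0) = 1, [x^n] u^a is a polynomial
   of degree at most n in a, so interpolation at a = 0, ..., n expresses
   [x^n] u^(-n-1) through the [x^n] u^k with 0 <= k <= n, and these are partial
   Bell polynomials. *)

Require Import Defs.
From HB Require Import structures.
From mathcomp Require Import all_boot all_order all_algebra.
From mathcomp Require Import boolp classical_sets constructive_ereal filter.
From mathcomp Require Import topology sequences ring zify.

Set Implicit Arguments.
Unset Strict Implicit.
Unset Printing Implicit Defensive.

Import Order.TTheory GRing.Theory Num.Theory.

Local Open Scope classical_set_scope.
Local Open Scope ring_scope.

(** * Polynomials modulo a power of ['X], and compositional inverses over a ring *)

Definition eq_modX (R : nzRingType) N (P Q : {poly R}) :=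
  forall i, (i < N)%N -> P`_i = Q`_i.

Section EqModX.
Variable R : comNzRingType.
Implicit Types (P Q u v : {poly R}) (N : nat).

Lemma eq_modXM N P P' Q Q' :
  eq_modX N P P' -> eq_modX N Q Q' -> eq_modX N (P * Q) (P' * Q').
Proof.
move=> PP QQ i iN; rewrite !coefM; apply: eq_bigr => j _.
rewrite PP ?QQ //; first exact: leq_ltn_trans (leq_subr _ _) iN.
by apply: leq_ltn_trans iN; rewrite -ltnS.
Qed.

Lemma eq_modXX N P Q k : eq_modX N P Q -> eq_modX N (P ^+ k) (Q ^+ k).
Proof.
move=> PQ; elim: k => [//|k IH]; rewrite !exprS; exact: eq_modXM.
Qed.

Lemma eq_modX_comp N P Q u : eq_modX N P Q -> eq_modX N (u \Po P) (u \Po Q).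
Proof.
move=> PQ i iN; rewrite !comp_polyE !coef_sum; apply: eq_bigr => j _.
by rewrite !coefZ (eq_modXX j PQ).
Qed.

Lemma eq_modX_deriv N P Q : eq_modX N.+1 P Q -> eq_modX N P^`() Q^`().
Proof. by move=> PQ i iN; rewrite !coef_deriv PQ. Qed.

Lemma eq_modX_dvd N P Q : eq_modX N P Q -> exists S, P = Q + 'X^N * S.
Proof.
move=> PQ; exists (drop_poly N (P - Q)).
have -> : 'X^N * drop_poly N (P - Q) = P - Q; last by rewrite addrC subrK.
apply/polyP => i; rewrite coefXnM coef_drop_poly.
by case: ltnP => iN; [rewrite coefB PQ // subrr | rewrite subnK].
Qed.

Lemma coef0_exp P n : (P ^+ n)`_0 = P`_0 ^+ n.
Proof. by rewrite -!horner_coef0 horner_exp. Qed.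

(** If x^N divides [P], the substitution multiplies the coefficient of degree [N] by u(0)^N = 1, so
    the lowest coefficient survives. *)
Lemma eq_modX_comp_cancel N P u :
  u`_0 = 1 -> eq_modX N (P \Po ('X * u)) 0 -> eq_modX N P 0.
Proof.
move=> u0; elim: N => [//|N IH] PG.
have PN : eq_modX N P 0 by apply: IH => i /ltnW; exact: PG.
move=> i; rewrite ltnS leq_eqVlt => /predU1P[->|]; last exact: PN.
have [S PE] := eq_modX_dvd PN; have := PG N (ltnSn N).
rewrite PE add0r comp_polyM comp_Xn_poly exprMn -mulrA !coefXnM ltnn subnn.
by rewrite coefM big_ord1 -!horner_coef0 !hornerE horner_comp !hornerE
  !horner_coef0 u0 expr1n mul1r.
Qed.

(** Each step corrects the coefficient of degree [N]. When u(0) = 1, the N-th power of ['X * u]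
    starts with x^N, so the inverse is found without division, over [R] itself. *)
Fixpoint reversion u N : {poly R} :=
  if N is N'.+1 then
    reversion u N' + ('X - (reversion u N' \Po ('X * u)))`_N *: 'X^N
  else 0.

Definition reversion_coef u n := ('X - (reversion u n \Po ('X * u)))`_n.+1.

Lemma reversionE u N :
  reversion u N = \sum_(n < N) reversion_coef u n *: 'X^(n.+1).
Proof. by elim: N => [|N IH]; rewrite ?big_ord0 // big_ord_recr /= -IH. Qed.

Lemma coef_reversion u n N :
  (n < N)%N -> (reversion u N)`_n.+1 = reversion_coef u n.
Proof.
move=> nN; rewrite reversionE coef_sum (bigD1 (Ordinal nN)) //= big1 ?addr0.
  by rewrite coefZ coefXn eqxx mulr1.
move=> i; rewrite -val_eqE /= => /negPf; rewrite coefZ coefXn eqSS eq_sym => ->.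
by rewrite mulr0.
Qed.

Lemma reversion_comp u N :
  u`_0 = 1 -> eq_modX N.+1 (reversion u N \Po ('X * u)) 'X.
Proof.
move=> u0; elim: N => [|N IH] i.
  by rewrite comp_poly0 coef0 coefX; case: i.
rewrite /= comp_polyD comp_polyZ comp_Xn_poly exprMn coefD coefZ coefXnM ltnS.
rewrite leq_eqVlt => /predU1P[->|iN]; last by rewrite iN mulr0 addr0 IH.
rewrite ltnn subnn coef0_exp u0 expr1n mulr1 coefB.
by rewrite addrC subrK.
Qed.

(** A left inverse Y of G = x u is also a right inverse: (G o Y) o G = G o (Y o G) = G to the given
    order, and G cancels on the right. *)
Lemma comp_reversion u N :
  u`_0 = 1 -> eq_modX N.+1 (('X * u) \Po reversion u N) 'X.
Proof.
move=> u0; set Y := reversion u N.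
have : eq_modX N.+1 (('X * u) \Po Y - 'X) 0.
  apply: (@eq_modX_comp_cancel _ _ u) => // i iN.
  rewrite comp_polyB comp_polyX -comp_polyA coefB.
  by rewrite (eq_modX_comp _ (reversion_comp u0)) // comp_polyXr subrr coef0.
by move=> h i iN; apply/eqP; rewrite -subr_eq0 -coefB h ?coef0.
Qed.

End EqModX.

(** * Lagrange inversion, negative powers and Bell polynomials in characteristic zero *)

Section CharZero.
Variables (F : fieldType) (natr_neq0 : forall n, (n.+1%:R : F) != 0).
Implicit Types u U P Q Y : {poly F}.

Lemma deriv_eq_modX N P Q :
  P`_0 = Q`_0 -> eq_modX N P^`() Q^`() -> eq_modX N.+1 P Q.
Proof.
move=> PQ0 PQ [//|i] iN; have := PQ i iN; rewrite !coef_deriv.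
by rewrite -[LHS]mulr_natr -[RHS]mulr_natr => /(mulIf (natr_neq0 i)).
Qed.

(* With G = x u and U = 1/u, this is the residue of G^(i-n-1) G' dx. *)
Lemma residue_power n i u U :
  u`_0 = 1 -> eq_modX n.+1 (u * U) 1 ->
  (('X * u) ^+ i * ('X * u)^`() * U ^+ n.+1)`_n = (i == n)%:R.
Proof.
move=> u0 uU; rewrite exprMn -!mulrA coefXnM; case: ltngtP => // [ltin|->].
  have [d nE] : exists d, n = (i + d.+1)%N.
    by exists (n - i.+1)%N; rewrite addnS -addSn subnKC.
  rewrite {}nE in ltin uU *; rewrite addKn -addnS.
  have uUd : eq_modX d.+2 (u * U) 1.
    by move=> j jd; rewrite uU // -addnS ltn_addl.
  (* With u U = 1 this becomes U^(d+1) + x U^(d+2) u'. Its coefficient of degree d+1 vanishes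
     because (U^(d+1))' = -(d+1) U^(d+2) u'. *)
  have -> : u ^+ i * (('X * u)^`() * U ^+ (i + d.+2)) =
    (u * U) ^+ i * (u * U) * U ^+ d.+1
      + 'X * ((u * U) ^+ i * (U ^+ d.+2 * u^`())).
    by rewrite derivM derivX exprD !exprS exprMn; ring.
  have uUi : eq_modX d.+2 ((u * U) ^+ i) 1.
    by rewrite -(expr1n _ i); apply: eq_modXX.
  have h1 : eq_modX d.+2 ((u * U) ^+ i * (u * U) * U ^+ d.+1) (U ^+ d.+1).
    rewrite -[X in eq_modX _ _ X]mul1r -[X in eq_modX _ _ (X * _)]mul1r.
    by apply: eq_modXM => //; apply: eq_modXM.
  have h2 : eq_modX d.+2 ((u * U) ^+ i * (U ^+ d.+2 * u^`()))
      (U ^+ d.+2 * u^`()).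
    by rewrite -[X in eq_modX _ _ X]mul1r; apply: eq_modXM.
  rewrite coefD h1 // coefXM /= h2 //.
  (* [U' = - U^2 u'], by differentiating [u U = 1] *)
  have dU : eq_modX d.+1 (U^`()) (- (U ^+ 2 * u^`())).
    have h3 : eq_modX d.+1 (U * (u * U)^`()) 0.
      move=> j jd; rewrite (eq_modXM (P' := U) (Q' := 0) _ _ jd) ?mulr0 //.
      by have := eq_modX_deriv uUd; rewrite derivC.
    have h4 : eq_modX d.+1 (u * U * U^`()) (1 * U^`()).
      by apply: eq_modXM => // j jd; rewrite uUd // ltnW.
    move=> j jd; move: (h3 j jd) (h4 j jd).
    have -> : U * (u * U)^`() = u * U * U^`() + U ^+ 2 * u^`().
      by rewrite derivM; ring.
    rewrite mul1r coefD coef0 coefN => /eqP.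
    by rewrite addr_eq0 => /eqP -> <-.
  have : (U ^+ d.+1)^`()`_d = - (U ^+ d.+2 * u^`())`_d *+ d.+1.
    rewrite deriv_exp coefMn.
    have -> // : eq_modX d.+1 (U^`() * U ^+ d)
        (- (U ^+ 2 * u^`()) * U ^+ d).
      exact: eq_modXM.
    have -> : - (U ^+ 2 * u^`()) * U ^+ d = - (U ^+ d.+2 * u^`()).
      by rewrite mulNr mulrAC -exprD.
    by rewrite coefN.
  rewrite coef_deriv -[LHS]mulr_natr -[RHS]mulr_natr.
  by move=> /(mulIf (natr_neq0 d)) ->; rewrite addNr.
rewrite subnn derivM derivX mul1r !coef0M coefD coefXM !coef0_exp u0.
have : (u * U)`_0 = 1 by rewrite uU // coef1.
by rewrite coef0M u0 mul1r addr0 => ->; rewrite !expr1n !mul1r.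
Qed.

(** Differentiating Y o G = x gives (Y' o G) G' = 1. After multiplication by U^(n+1) and expansion
    in powers of G, [residue_power] leaves only the coefficient of degree n of Y'. *)
Lemma lagrange_inversion n u U Y :
  u`_0 = 1 -> eq_modX n.+1 (u * U) 1 ->
  eq_modX n.+2 (Y \Po ('X * u)) 'X ->
  Y`_n.+1 *+ n.+1 = (U ^+ n.+1)`_n.
Proof.
move=> u0 uU YG; have := eq_modX_deriv YG; rewrite deriv_comp derivX => dYG.
have : ((Y^`() \Po ('X * u)) * ('X * u)^`() * U ^+ n.+1)`_n = (U ^+ n.+1)`_n.
  by rewrite (eq_modXM (P' := 1) (Q' := U ^+ n.+1) dYG) ?mul1r.
move=> <-; rewrite comp_polyE -mulrA mulr_suml coef_sum -coef_deriv.
under eq_bigr => i _ do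
  rewrite -scalerAl coefZ mulrA residue_power // mulr_natr mulrb.
rewrite -big_mkcond /=; case: (ltnP n (size Y^`())) => nY.
  by rewrite (big_pred1 (Ordinal nY)).
rewrite big_pred0 ?nth_default // => i.
by apply/negbTE; rewrite neq_ltn (leq_trans (ltn_ord i) nY).
Qed.

(* The beta integral gives neg_power n = beta_const n * z^(-n-1) *
   int_0^z t^n (1-t)^n dt, which agrees with z^(-n-1) to order n+1 at z = 1. *)
Definition beta_const n : F := (n.*2.+1)`!%:R / (n`! * n`!)%:R.

Definition neg_power n : {poly F} :=
  \poly_(k < n.+1) (beta_const n * ((-1) ^+ k * 'C(n, k)%:R / (n + k).+1%:R)).

Lemma factr_neq0 n : (n`!%:R : F) != 0.
Proof. by case: n`! (fact_gt0 n) => // k _; exact: natr_neq0. Qed.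

(** The sum is the integral of t^a (1-t)^n over [0,1]. The induction uses (1-t)^(n+1) = (1-t)^n - t
    (1-t)^n, which raises [a]; hence [a] is general. *)
Lemma beta_sum n a :
  \sum_(k < n.+1) ((-1) ^+ k * 'C(n, k)%:R / (a + k).+1%:R : F)
  = (a`! * n`!)%:R / (a + n).+1`!%:R.
Proof.
elim: n a => [|n IH] a.
  rewrite big_ord1 /= bin0 !addn0 expr0 !mul1r fact0 muln1 factS natrM invfM.
  by rewrite mulrCA divff ?mulr1 ?factr_neq0.
rewrite big_ord_recl /= big_ord_recr /=.
transitivity (
 \sum_(k < n.+1) ((-1) ^+ k * 'C(n, k)%:R / (a + k).+1%:R : F) -
 \sum_(k < n.+1) ((-1) ^+ k * 'C(n, k)%:R / (a.+1 + k).+1%:R : F)).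
  rewrite [X in _ = X - _]big_ord_recl [X in _ = _ - X]big_ord_recr /=.
  rewrite opprD addrA !bin0 -!addrA; congr (_ + _).
  rewrite addrA -sumrN -big_split /=; congr (_ + _).
    apply: eq_bigr => i _; rewrite /bump /= !add1n binS natrD exprS addnS addSn.
    by move: (_.+2%:R^-1) => D; ring.
  by rewrite /bump /= add1n !binn exprS addnS addSn !mulN1r !mulNr.
rewrite !IH addnS addSn [(a + n).+2`!]factS [a.+1`!]factS [n.+1`!]factS.
have e0 := natr_neq0 (a + n).+1.
have eE : (a + n).+2%:R = a.+1%:R + n.+1%:R :> F by rewrite -natrD addnS.
have nE : n.+1%:R = (a + n).+2%:R - a.+1%:R :> F by rewrite eE addrC addKr.
move: (factr_neq0 (a + n).+1); move: (a + n).+1`! a`! n`! => D A B.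
rewrite !natrM nE.
move: ((a + n).+2%:R) (a.+1%:R) e0 {eE nE} => e x e0 D0.
by field; rewrite D0 e0.
Qed.

Lemma coef_exp1BX n k :
  ((1 - 'X : {poly F}) ^+ n)`_k = (-1) ^+ k * 'C(n, k)%:R.
Proof.
elim: n k => [|n IH] [|k]; rewrite ?expr0 ?coef1 ?bin0 ?bin0n ?mulr0 ?mulr1 //.
  by rewrite coef0_exp coefB coef1 coefX subr0 expr1n.
rewrite exprS mulrBl mul1r coefB coefXM /= !IH binS natrD exprS.
by ring.
Qed.

(** Put H = ['X^(n.+1) * T]. Then H(1) = 1 and (1-x)^n divides H'. As x divides 1 - u, x^n divides
    (H o u)', and H o u has constant term 1. *)
Lemma neg_powerP n u :
  u`_0 = 1 -> eq_modX n.+1 (u ^+ n.+1 * (neg_power n \Po u)) 1.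
Proof.
move=> u0; set T := neg_power n.
have -> : u ^+ n.+1 * (T \Po u) = ('X^(n.+1) * T) \Po u.
  by rewrite comp_polyM comp_Xn_poly.
apply: deriv_eq_modX.
  rewrite coef1 /= -horner_coef0 horner_comp horner_coef0 u0 hornerM hornerXn.
  rewrite expr1n mul1r horner_poly.
  under eq_bigr => k _ do rewrite expr1n mulr1.
  rewrite -mulr_sumr beta_sum /beta_const addnn mulrA.
  rewrite divfK ?divff ?factr_neq0 //.
  by rewrite natrM mulf_neq0 ?factr_neq0.
rewrite deriv_comp derivC.
have -> : ('X^(n.+1) * T)^`() = beta_const n *: ('X^n * (1 - 'X) ^+ n).
  apply/polyP => j; rewrite coef_deriv coefZ !coefXnM ltnS.
  case: ltnP => nj; first by rewrite mul0rn mulr0.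
  rewrite coef_exp1BX subSS coef_poly -(subnKC nj) addKn.
  move: (j - n)%N => k; case: ltnP => nk; last first.
    by rewrite bin_small // mul0rn mulr0 mulr0.
  rewrite -[LHS]mulr_natr -!mulrA mulVf ?mulr1 //; exact: natr_neq0.
have [|S uE] := @eq_modX_dvd _ 1 u 1; first by case=> // _; rewrite coef1.
have -> : (beta_const n *: ('X^n * (1 - 'X) ^+ n) \Po u) * u^`() =
    'X^n * (beta_const n *: (u ^+ n * (- S) ^+ n * u^`())).
  rewrite comp_polyZ comp_polyM !rmorphXn rmorphB /= comp_polyX comp_polyC.
  have -> : 1 - u = 'X * - S.
    by rewrite uE expr1 mulrN opprD addrA subrr add0r.
  by rewrite -scalerAl -scalerAr exprMn; congr (_ *: _); ring.
by move=> i iN; rewrite coefXnM iN coef0.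
Qed.

Lemma lagrange_neg_power n u Y :
  u`_0 = 1 -> eq_modX n.+2 (Y \Po ('X * u)) 'X ->
  Y`_n.+1 *+ n.+1 = (neg_power n \Po u)`_n.
Proof.
move=> u0 YG; have TP := neg_powerP (n := n) u0.
set V := _ \Po u in TP *; pose U := u ^+ n * V.
have uU : eq_modX n.+1 (u * U) 1 by rewrite /U mulrA -exprS.
rewrite (lagrange_inversion u0 uU YG).
(* The same product regroups as V (u U)^(n+1), so U^(n+1) and V agree to this order. *)
have <- : (U ^+ n.+1 * (u ^+ n.+1 * V))`_n = (U ^+ n.+1)`_n.
  by rewrite (eq_modXM (P' := U ^+ n.+1) _ TP) ?mulr1.
have h : eq_modX n.+1 (V * (u * U) ^+ n.+1) (V * 1 ^+ n.+1).
  by apply: eq_modXM => //; exact: eq_modXX.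
by rewrite mulrA -exprMn mulrC (mulrC U) h // expr1n mulr1.
Qed.

(* The generating polynomial of the left-hand sides is a product of truncated
   exponentials, hence satisfies P' = (sum y) P up to order N. *)
Lemma multinomial_expansion (I : finType) N (y : I -> {poly F}) k :
  (k <= N)%N ->
  \sum_(i : {ffun I -> 'I_N.+1} | (\sum_j i j)%N == k)
    (\prod_j (i j)`!)%N%:R^-1 *: \prod_j y j ^+ i j
  = k`!%:R^-1 *: (\sum_j y j) ^+ k.
Proof.
pose E j : {poly {poly F}} := \poly_(e < N.+1) (e`!%:R^-1 *: y j ^+ e).
have EP : (\prod_j E j)`_0 = 1 /\
    eq_modX N (\prod_j E j)^`() ((\sum_j y j)%:P * \prod_j E j).
  elim/big_ind2: _ => [|s P t Q [P0 dP] [Q0 dQ]|j _].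
  - by rewrite coef1 derivC mul0r.
  - split; first by rewrite coef0M P0 Q0 mulr1.
    move=> i iN; rewrite derivM coefD polyCD mulrDl coefD.
    rewrite (eq_modXM dP (Q := Q) (Q' := Q)) //.
    rewrite (eq_modXM (P := P) (P' := P) _ dQ) //.
    by rewrite -!coefD; congr (polyseq _)`__; ring.
  - split=> [|i iN]; first by rewrite coef_poly expr0 fact0 invr1 scale1r.
    rewrite coef_deriv coefCM !coef_poly ltnS iN (leqW iN).
    rewrite -scaler_nat scalerA factS natrM invfM mulrA divff // mul1r.
    by rewrite exprS scalerAr.
have coefE_prod : forall k, (k <= N)%N ->
    (\prod_j E j)`_k = k`!%:R^-1 *: (\sum_j y j) ^+ k.
  elim=> [_|n IH nN]; first by rewrite EP.1 expr0 invr1 scale1r.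
  have := EP.2 n nN; rewrite coef_deriv coefCM IH 1?ltnW // => h.
  have -> : (\prod_j E j)`_n.+1 = n.+1%:R^-1 *: ((\prod_j E j)`_n.+1 *+ n.+1).
    by rewrite -scaler_nat scalerA mulVf // scale1r.
  by rewrite h factS natrM invfM -scalerAr scalerA exprS.
move=> kN; rewrite -coefE_prod //.
rewrite (eq_bigr (fun j => \sum_(e < N.+1) (e`!%:R^-1 *: y j ^+ e) *: 'X^e));
  last by move=> j _; rewrite /E poly_def.
rewrite bigA_distr_bigA coef_sum big_mkcond; apply: eq_bigr => i _.
rewrite (eq_bigr (fun j => ((i j)`!%:R^-1 *: y j ^+ i j)%:P * 'X^(i j)));
  last by move=> j _; rewrite mul_polyC.
rewrite big_split /= -rmorph_prod prodrXr mul_polyC coefZ coefXn eq_sym.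
by case: eqP => _; rewrite ?mulr0 // mulr1 scaler_prod prodfV natr_prod.
Qed.

(** By the multinomial theorem, the constraint on the number of parts selects the k-th power and the
    one on their total selects the coefficient of degree [N]; the factorials j! cancel. *)
Lemma bell_polyE N k (c : nat -> F) : (k <= N)%N ->
  bell_poly N k (fun j => j`!%:R * c j) =
  N`!%:R / k`!%:R * ((\sum_(j < N) c j.+1 *: 'X^(j.+1)) ^+ k)`_N.
Proof.
move=> kN; rewrite /bell_poly -[in RHS]mulrA -coefZ.
rewrite -(multinomial_expansion _ kN) coef_sum mulr_sumr big_mkcondr.
apply: eq_bigr => i _.
rewrite (eq_bigr (fun j : 'I_N => (c j.+1 ^+ i j)%:P * 'X^(j.+1 * i j)));
  last by move=> j _; rewrite -mul_polyC exprMn -rmorphXn -exprM.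
rewrite [in RHS]big_split /= -rmorph_prod prodrXr mul_polyC !coefZ coefXn.
rewrite eq_sym; case: eqP => _; rewrite ?mulr0 // mulr1 -mulrA; congr (_ * (_ * _)).
apply: eq_bigr => j _; rewrite mulrAC divff ?mul1r //.
exact: factr_neq0.
Qed.

(** Both sides agree term by term in k: the Bell polynomial is a multiple of the coefficient of
    degree n of u^k, and the remaining factors match the coefficient of degree k of
    [neg_power n]. *)
Lemma hensel_termE (c : nat -> F) (u : {poly F}) n :
  c 1%N != 0 -> (forall j, u`_j = c j.+1 / c 1%N) ->
  hensel_term c n =
  n.+1%:R^-1 * (neg_power n \Po u)`_n * (- (c 0%N / c 1%N)) ^+ n.+1.
Proof.
move=> c1 uE.
have bell k : (k <= n)%N -> bell_poly (n + k) k (fun j => j`!%:R * c j) =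
   (n + k)`!%:R / k`!%:R * c 1%N ^+ k * (u ^+ k)`_n.
  move=> kn; rewrite bell_polyE ?leq_addl // -[in RHS]mulrA; congr (_ * _).
  have : eq_modX (n + k).+1 (\sum_(j < n + k) c j.+1 *: 'X^(j.+1))
      (c 1%N *: ('X * u)).
    move=> [|i] iN; rewrite coefZ coefXM coef_sum.
      by rewrite big1 ?mulr0 // => j _; rewrite coefZ coefXn mulr0.
    rewrite (bigD1 (Ordinal (iN : (i < n + k)%N))) //= big1 ?addr0.
      by rewrite coefZ coefXn eqxx mulr1 uE mulrC divfK.
    move=> j; rewrite -val_eqE /= => /negPf.
    by rewrite coefZ coefXn eqSS eq_sym => ->; rewrite mulr0.
  move=> /(eq_modXX k) -> //; rewrite exprZn exprMn coefZ coefXnM.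
  by rewrite ltnNge leq_addl /= addnK.
rewrite /hensel_term exprNn mulrA; congr (_ * _).
rewrite /neg_power poly_def (raddf_sum (comp_poly u)) coef_sum.
rewrite mulr_sumr mulr_suml.
apply: eq_bigr => k _; have kn : (k <= n)%N by rewrite -ltnS.
move: (nat_of_ord k) kn => {}k kn.
rewrite bell // /= comp_polyZ comp_Xn_poly coefZ /beta_const.
have c1k : c 1%N ^+ k != 0 by rewrite expf_neq0.
move: (u ^+ k)`_n (c 1%N ^+ k) c1k => v d d0 {bell uE c1 u c}.
have binF a b : (b <= a)%N ->
    'C(a, b)%:R = a`!%:R / (b`!%:R * (a - b)`!%:R) :> F.
  move=> ba; rewrite -(bin_fact ba) !natrM mulfK //.
  by rewrite mulf_neq0 ?factr_neq0.
rewrite !binF //; last by lia.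
have -> : (n.*2.+1 - (n - k) = (n + k).+1)%N by lia.
rewrite [(n + k).+1`!]factS [n.+1`!]factS !natrM.
(* The factor (-1)^(n+1) belongs to the power of -c_0/c_1, and (-1)^k to [neg_power n]. *)
have -> : (-1) ^+ (n - k).+1 = (-1) ^+ n.+1 * (-1) ^+ k :> F.
  rewrite -[in RHS](subnK kn) -addSn exprD -mulrA -exprMn mulrNN mulr1 expr1n.
  by rewrite mulr1.
field.
by rewrite -natrD !nat1r !natr_neq0 !factr_neq0.
Qed.

End CharZero.

(** * Units, convergent series and roots in Z_p, and the rescaled Taylor expansion *)

Section Padic.
Variables (p : nat) (p_pr : prime p).
Notation Zp := (padic_int p_pr).
Implicit Types x y z : Zp.

Lemma padic_resB0 x y n :
  padic_res (x - y) n = 0 <-> padic_res x n = padic_res y n.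
Proof.
have -> : padic_res (x - y) n =
    ((padic_res x n - padic_res y n) %% (p ^ n)%N)%Z.
  by rewrite /= modzDmr.
split=> [/eqP|->]; last by rewrite subrr mod0z.
have -> : (0 : int) = (0 %% (p ^ n)%N)%Z by rewrite mod0z.
by rewrite eqz_mod_dvd subr0 -eqz_mod_dvd !padic_res_small => /eqP.
Qed.

Lemma padic_congrP x y n :
  padic_res x n = padic_res y n <-> exists z, x = y + p%:R ^+ n * z.
Proof.
rewrite -padic_resB0 padic_dvdP; split=> -[z zE]; exists z.
  by rewrite -zE addrC subrK.
by rewrite zE addrC addKr.
Qed.

(** Bezout coefficients invert [x] modulo each p^n; they are coherent because an inverse modulo p^n
    is unique. *)
Lemma padic_res1_unit x : padic_res x 1 != 0 -> x \is a GRing.unit.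
Proof.
move=> x1.
have cop n : coprimez (padic_res x n) (p ^ n)%N.
  case: n => [|n]; first by rewrite expn0 coprimezE coprimen1.
  rewrite coprimezE absz_nat coprimeXr // coprime_sym prime_coprime //.
  apply: contra x1 => pd; rewrite -(@padic_res_le _ _ x 1 n.+1) //.
  by rewrite expn1; apply/eqP/dvdz_mod0P; rewrite dvdzE absz_nat.
pose v n := (egcdz (padic_res x n) (p ^ n)%N).1.
have vP n : (v n * padic_res x n = 1 %[mod (p ^ n)%N])%Z.
  rewrite /v; case: egcdzP => a b /= ab _; move: ab.
  rewrite (eqP (cop n)) => <-.
  by rewrite addrC modzMDl.
have hv n : (v n.+1 %% (p ^ n)%N)%Z = (v n %% (p ^ n)%N)%Z.
  have vS : (v n.+1 * padic_res x n = 1 %[mod (p ^ n)%N])%Z.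
    rewrite padic_coh modzMmr -[LHS]modz_expS vP modz_expS //.
  apply/eqP; rewrite eqz_mod_dvd -(@Gauss_dvdzl _ _ (padic_res x n)).
    by rewrite mulrBl -eqz_mod_dvd vS vP.
  by rewrite coprimez_sym.
apply/unitrP; exists (padic_mk p_pr hv).
suff h : padic_mk p_pr hv * x = 1 by split; last rewrite mulrC.
by apply: padic_eqP => n /=; rewrite modzMml vP.
Qed.

Lemma padic_natr_neq0 n : (n.+1%:R : Zp) != 0.
Proof.
apply/eqP => /(congr1 (fun x => padic_res x n.+1)).
rewrite padic_res0 padic_natE modz_small // lez_nat ltz_nat.
by rewrite ltn_expl ?prime_gt1.
Qed.

Lemma padic_num_natr_neq0 n : (n.+1%:R : padic_num p_pr) != 0.
Proof. by rewrite -(rmorph_nat (@tofrac Zp)) tofrac_eq0 padic_natr_neq0. Qed.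

Lemma padic_valE x (k : nat) :
  padic_val x = k%:Z%:E -> exists2 y, x = p%:R ^+ k * y & y \is a GRing.unit.
Proof.
rewrite /padic_val; case: pselect => // h [].
case: ex_minnP => m xm mP [mk]; rewrite {}mk in xm mP *.
have /padic_dvdP [y xE] : padic_res x k = 0.
  (* At level 0 every residue is zero; above it, minimality of k is applied to k - 1. *)
  case: k xm mP => [|k] xm mP; first by rewrite padic_coh expn0 modz1.
  by apply/eqP; case: eqP => // /eqP /mP; rewrite ltnn.
exists y => //; apply: padic_res1_unit; apply: contra_neq xm => y1.
have /padic_dvdP [z zE] := y1.
by apply/padic_dvdP; exists z; rewrite xE zE mulrA -exprD addn1.
Qed.

Lemma horner_congr (P : {poly Zp}) x y n :
  padic_res x n = padic_res y n -> padic_res P.[x] n = padic_res P.[y] n.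
Proof.
move=> xy; elim/poly_ind: P => [|P c IH]; first by rewrite !horner0.
have resD a b : padic_res (a + b : Zp) n =
  ((padic_res a n + padic_res b n) %% (p ^ n)%N)%Z by [].
have resM a b : padic_res (a * b : Zp) n =
  ((padic_res a n * padic_res b n) %% (p ^ n)%N)%Z by [].
by rewrite !hornerMXaddC !resD !resM IH xy.
Qed.

(** From index n on, the partial sums no longer change modulo p^n, so the diagonal residues are
    those of the limit. *)
Lemma padic_series_cvg (t : nat -> Zp) :
  (forall n, padic_res (t n) n.+1 = 0) ->
  exists S, (forall n, padic_res S n = padic_res (series t n) n) /\
    series t n @[n --> \oo] --> S.
Proof.
move=> t0.
have stepE n : padic_res (series t n.+1) n = padic_res (series t n) n.
  by apply/padic_resB0; rewrite seriesSB padic_coh t0 mod0z.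
have hu n : (padic_res (series t n.+1) n.+1 %% (p ^ n)%N)%Z =
            (padic_res (series t n) n %% (p ^ n)%N)%Z.
  by rewrite -padic_coh stepE padic_res_small.
have SE n : padic_res (padic_mk p_pr hu) n = padic_res (series t n) n.
  by rewrite /= padic_res_small.
exists (padic_mk p_pr hu); split=> // A [n _ nA].
exists n => // N /= nN; apply: nA => /=.
by rewrite -[LHS](padic_res_le _ nN) -SE padic_res_le.
Qed.

(** The partial sums are values at [w] of the truncated inverse of G = x u, so G sends the n-th one
    to [w] modulo p^n. [horner_congr] passes this to the limit, one residue at a time. *)
Lemma reversion_root (u : {poly Zp}) (w w' : Zp) e :
  u`_0 = 1 -> w = p%:R ^+ e.+1 * w' ->
  exists S, [/\ series (fun n => reversion_coef u n * w ^+ n.+1) n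
                  @[n --> \oo] --> S,
    ('X * u).[S] = w & exists z, S = p%:R ^+ e.+1 * z].
Proof.
move=> u0 wE; pose t n := reversion_coef u n * w ^+ n.+1.
pose v n := reversion_coef u n * w' ^+ n.+1 * p%:R ^+ (e * n).
have tE n : t n = p%:R ^+ e.+1 * (p%:R ^+ n * v n).
  by rewrite /t /v wE exprMn [p%:R ^+ e.+1 ^+ _]exprS -exprM mulSn exprD; ring.
have [|S [SE tS]] := @padic_series_cvg t.
  move=> n; apply/padic_dvdP; rewrite tE.
  by eexists; rewrite mulrA -exprD addSn addnC -addSn exprD -mulrA.
have tY n : series t n = (reversion u n).[w].
  rewrite seriesEord /= reversionE horner_sum.
  by apply: eq_bigr => i _; rewrite hornerZ hornerXn.
exists S; split=> //.
  apply: padic_eqP => n; rewrite (horner_congr _ (SE n)) tY -horner_comp.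
  have [Q ->] := eq_modX_dvd (comp_reversion (N := n) u0).
  rewrite hornerD hornerX hornerM hornerXn; apply/padic_congrP.
  have wn : w ^+ n = p%:R ^+ n * (p%:R ^+ (e * n) * w' ^+ n).
    by rewrite wE exprMn -exprM mulSn exprD mulrA.
  by exists (p%:R ^+ (e * n) * w' ^+ n * w * Q.[w]); rewrite exprSr wn !mulrA.
(* Modulo p^(e+1), [S] is the sum of its first e+1 terms, each a multiple of p^(e+1). *)
apply/padic_dvdP; rewrite SE; apply/padic_dvdP.
exists (\sum_(n < e.+1) p%:R ^+ n * v n).
by rewrite seriesEord /= mulr_sumr; apply: eq_bigr => n _; rewrite tE.
Qed.

(** The coefficients are c_(j+1)/c_1, kept in Z_p by divided derivatives. The constant one is set
    apart because c_1 is written with p^(-k). *)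
Definition hensel_series (f : {poly Zp}) m k (r c1 : Zp) : {poly Zp} :=
  \poly_(j < m)
    (if j is i.+1 then c1^-1 * (p%:R ^+ (i * k) * f^`N(j.+1).[r]) else 1).

(** In Taylor's formula p^(jk) = p^(2k) p^((j-2)k) for j >= 2; the term j = 1 takes its second
    factor p^k from f'(r). *)
Lemma hensel_shift (f : {poly Zp}) m k (r c0 c1 y : Zp) :
  (size f <= m.+1)%N -> c1 \is a GRing.unit ->
  f.[r] = p%:R ^+ (2 * k) * c0 -> f^`().[r] = p%:R ^+ k * c1 ->
  f.[r + p%:R ^+ k * y] =
  p%:R ^+ (2 * k) * (c0 + c1 * ('X * hensel_series f m k r c1).[y]).
Proof.
move=> fm c1u f0 f1; rewrite (nderiv_taylor_wide (mulrC _ _) fm) big_ord_recl.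
rewrite nderivn0 expr0 mulr1 f0 mulrDr; congr (_ + _).
rewrite hornerM hornerX horner_poly !mulr_sumr.
apply: eq_bigr => -[[|i] im] _ /=.
  by rewrite /bump /= nderivn1 f1 mul2n -addnn [p%:R ^+ (k + k)]exprD; ring.
have -> : (p%:R ^+ k * y) ^+ bump 0 i.+1 =
    p%:R ^+ (2 * k) * p%:R ^+ (i * k) * (y * y ^+ i.+1).
  rewrite exprMn -exprM -exprD -exprS; congr (_ ^+ _ * _).
  by rewrite /bump; lia.
transitivity (p%:R ^+ (2 * k) *
    ((c1 / c1) * (p%:R ^+ (i * k) * f^`N(i.+2).[r] * (y * y ^+ i.+1)))).
  by rewrite divrr // mul1r; ring.
by ring.
Qed.

Lemma padic_emb_pX x k :
  padic_emb (p%:R ^+ k * x) = p%:R ^+ k * padic_emb x.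
Proof. by rewrite /padic_emb rmorphM rmorphXn rmorph_nat. Qed.

Lemma padic_num_p_neq0 : (p%:R : padic_num p_pr) != 0.
Proof. by have := padic_num_natr_neq0 p.-1; rewrite prednK ?prime_gt0. Qed.

End Padic.

(** * The coefficients c_j and the terms of the series as elements of Z_p *)

Section Hensel.
Variables (p : nat) (p_pr : prime p).
Notation Zp := (padic_int p_pr).
Variables (f : {poly Zp}) (m k : nat) (r0 : int) (c0 c1 : Zp).
Hypotheses (f0 : f.[r0%:~R] = p%:R ^+ (2 * k) * c0)
           (f1 : f^`().[r0%:~R] = p%:R ^+ k * c1).
Hypotheses (m_gt0 : (0 < m)%N) (c1u : c1 \is a GRing.unit).
Let u := hensel_series f m k r0%:~R c1.

Lemma hensel_series0 : u`_0 = 1.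
Proof. by rewrite coef_poly m_gt0. Qed.

Lemma hensel_c_le j : (j <= m)%N -> hensel_c f m k%:Z r0 j =
  p%:R ^ ((j%:Z - 2) * k%:Z) * padic_emb f^`N(j).[r0%:~R].
Proof.
move=> jm; rewrite /hensel_c jm nderivn_def hornerMn /padic_emb rmorphMn /=.
by rewrite -(mulr_natr (tofrac _)) mulfK //; apply: factr_neq0 => ?;
  exact: padic_num_natr_neq0.
Qed.

Lemma hensel_c0 : hensel_c f m k%:Z r0 0 = padic_emb c0.
Proof.
rewrite hensel_c_le // nderivn0 f0 padic_emb_pX mulrA.
have -> : (0 - 2) * k%:Z = - (2 * k)%N%:Z by lia.
by rewrite -exprnN mulVf ?mul1r // expf_neq0 ?padic_num_p_neq0.
Qed.

Lemma hensel_cS j : hensel_c f m k%:Z r0 j.+1 = padic_emb (c1 * u`_j).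
Proof.
rewrite coef_poly; case: (ltnP j m) => jm; last first.
  by rewrite /hensel_c ltnNge jm /= mulr0 /padic_emb rmorph0.
rewrite hensel_c_le //; case: j jm => [|j] jm.
  rewrite nderivn1 f1 padic_emb_pX mulrA mulr1.
  have -> : (1 - 2) * k%:Z = - k%:Z by ring.
  by rewrite -exprnN mulVf ?mul1r // expf_neq0 ?padic_num_p_neq0.
rewrite mulrA divrr // mul1r padic_emb_pX; congr (_ * _).
by rewrite exprnP PoszM; congr (_ ^ (_ * _)); lia.
Qed.

(** Despite their denominators the terms are integral: Lagrange inversion is applied in the fraction
    field to the image of an inverse computed over Z_p. *)
Lemma hensel_termE_padic n : hensel_term (hensel_c f m k%:Z r0) n =
  padic_emb (reversion_coef u n * (- (c0 / c1)) ^+ n.+1).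
Proof.
have nat0 := @padic_num_natr_neq0 _ p_pr.
pose iota : {rmorphism Zp -> padic_num p_pr} := @tofrac Zp.
have c1E : hensel_c f m k%:Z r0 1 = padic_emb c1.
  by rewrite hensel_cS hensel_series0 mulr1.
have c1n0 : padic_emb c1 != 0.
  by rewrite /padic_emb tofrac_eq0; apply: contraTneq c1u => ->; rewrite unitr0.
rewrite (@hensel_termE _ nat0 _ (map_poly iota u)); first last.
- by move=> j; rewrite hensel_cS c1E coef_map /padic_emb rmorphM mulrC mulKf.
- by rewrite c1E.
rewrite hensel_c0 c1E /padic_emb rmorphM rmorphXn rmorphN rmorphM rmorphV //=.
congr (_ * _).
have Yu : eq_modX n.+2
    (map_poly iota (reversion u n.+1) \Po ('X * map_poly iota u)) 'X.
  rewrite -[X in X * _](map_polyX iota) -rmorphM -map_comp_poly.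
  rewrite -(map_polyX iota).
  by move=> i iN; rewrite !coef_map (reversion_comp hensel_series0).
rewrite -(lagrange_neg_power nat0 _ Yu) ?coef_map ?hensel_series0 ?rmorph1 //.
by rewrite coef_reversion // -[X in _ * X]mulr_natl mulrA mulVf ?mul1r.
Qed.

End Hensel.

(** The terms are formed in the fraction field; [t] lifts them to Z_p, where the topology lives. *)
Theorem theorem3p2 (p : nat) (p_pr : prime p) (m : nat)
    (f : {poly padic_int p_pr}) (hf : (size f <= m.+1)%N)
    (nu kappa : int) (hkappa : 0 <= 2 * kappa) (hnu : 2 * kappa < nu)
    (r0 : int)
    (hr0 : padic_eqmod nu f.[r0%:~R] 0)
    (hr0' : padic_val (f^`()).[r0%:~R] = kappa%:E) :
  exists (t : nat -> padic_int p_pr) (S : padic_int p_pr),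
    [/\ forall n, padic_emb (t n) = hensel_term (hensel_c f m kappa r0) n,
        series t n @[n --> \oo] --> S
      & let r := r0%:~R + p%:R ^ kappa * S in
        root f r /\ padic_eqmod (nu - kappa) r r0%:~R].
Proof.
case: kappa hkappa hnu hr0' => // k _ {}hnu /padic_valE [c1 f1 c1u].
case: nu hnu hr0 => // n hn [z]; rewrite subr0 => f0.
(* The strict inequality leaves a factor p^(e+1) in c_0, which makes -c_0/c_1 divisible by p. *)
have {hn} [e nE] : exists e, n = (2 * k + e.+1)%N.
  by exists (n - (2 * k).+1)%N; lia.
rewrite {}nE in f0 *.
have {}f0 : f.[r0%:~R] = p%:R ^+ (2 * k) * (p%:R ^+ e.+1 * z).
  by rewrite f0 -exprnP exprD mulrA.
set c0 := _ * z in f0.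
have p0 : (p%:R : padic_int p_pr) != 0.
  by have := padic_natr_neq0 p_pr p.-1; rewrite prednK ?prime_gt0.
(* A constant f would have zero derivative, against [c1] being a unit. *)
have m_gt0 : (0 < m)%N.
  rewrite lt0n; apply: contraTneq c1u => m0; move: f1.
  have [c ->] : exists c, f = c%:P.
    by exists f`_0; apply: size1_polyC; rewrite -m0.
  rewrite derivC horner0 => /esym/eqP.
  rewrite mulf_eq0 expf_eq0 (negPf p0) andbF.
  by move=> /eqP ->; rewrite unitr0.
set u := hensel_series f m k r0%:~R c1.
have u0 : u`_0 = 1 by exact: hensel_series0.
have wE : - (c0 / c1) = p%:R ^+ e.+1 * (- (z / c1)) by rewrite mulrN mulrA.
have [S [tS GS [s SE]]] := reversion_root u0 wE.
exists (fun i => reversion_coef u i * (- (c0 / c1)) ^+ i.+1), S; split=> //.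
  by move=> i; rewrite (hensel_termE_padic f0 f1).
split.
  rewrite /root -exprnP (hensel_shift _ hf c1u f0 f1) GS mulrN mulrCA divrr //.
  by rewrite mulr1 subrr mulr0.
(* Here r - r_0 = p^k S with S = p^(e+1) s, and nu - kappa = k + e + 1. *)
exists s; rewrite addrC addKr SE -exprnP mulrA -exprD.
by congr (_ * _); rewrite exprnP; congr (_ ^ _); lia.
Qed.
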